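(* Let $\bar z=(\bar x,\bar\lambda)\in\Lambda(0)$ be a given KKT point of $\mathrm{P}(0)$. Suppose that: (A1) the set $\Lambda(0)$ of KKT points of $\mathrm{P}(0)$ is nonempty; (A2) $g$ is twice continuously differentiable on its domain; (A3) there exist a neighborhood $\mathcal N_0\subset\mathbb R^{n+m}$ of the origin and a neighborhood $\mathcal N_{\bar z}$ of $\bar z$ such that for each $\delta\in\mathcal N_0$ the set $\psi(\delta):=\mathcal N_{\bar z}\cap L^{-1}(\delta)$ is single-valued (consists of exactly one point), and $\psi$ is Lipschitz continuous on $\mathcal N_0$ with a Lipschitz constant $\gamma>0$; (A4) there exists a constant $0\le\kappa<1/\gamma$ such that $\|E_g(\bar z)\|_F\le\kappa$, where $E_g(\bar z):=\sum_{i=1}^m\bar\lambda_i\nabla^2 g_i(\bar x)$. Then there exist a neighborhood $\mathcal N_\rho$ of $\bar z$ and a contraction factor $\omega\in(0,1)$ such that the following holds: if $z^0=(x^0,\lambda^0)\in\mathcal N_\rho$ with $x^0\in\Omega$, and $\{z^j\}_{j\ge1}$, $z^j=(x^j,\lambda^j)$, is a sequence generated by the full-step sequential convex programming method from $x^0$, i.e. $z^j$ is a KKT point of $\mathrm{P}_{\mathrm{cvx}}(x^{j-1};0)$ for every $j\ge1$, then $$\|z^{j+1}-\bar z\|\le\omega\|z^j-\bar z\|\quad\text{for all } j\ge 0.$$ Consequently, the sequence $\{z^j\}$ converges linearly to the KKT point $\bar z$ of $\mathrm{P}(0)$.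
   Context: Data: $c\in\mathbb R^n$; a function $g:\mathbb R^n\to\mathbb R^m$ with components $g_i$ and Jacobian matrix $g'(x)\in\mathbb R^{m\times n}$; a convex set $\Omega\subseteq\mathbb R^n$. $\|\cdot\|$ is the $L_2$-norm (Euclidean norm) and $\|\cdot\|_F$ the Frobenius norm. Write $z=(x,\lambda)\in\mathbb R^n\times\mathbb R^m$. The problem $\mathrm{P}(0)$ is: $\min_x c^Tx$ subject to $g(x)=0$, $x\in\Omega$. (It is the member at parameter value $\xi=0$ of the family with constraint $g(x)+M\xi=0$, where the parameter is kept fixed at $0$.) Normal cones: for a convex set $C$, $N_C(x):=\{u: u^T(v-x)\le 0\ \forall v\in C\}$ if $x\in C$, and $N_C(x):=\emptyset$ if $x\notin C$. Put $K:=\Omega\times\mathbb R^m$, so $N_K(x,\lambda)=N_\Omega(x)\times\{0\}$. A pair $(x,\lambda)$ is a KKT point of $\mathrm{P}(0)$ if $0\in c+g'(x)^T\lambda+N_\Omega(x)$ and $g(x)=0$. $\Lambda(0)$ denotes the set of KKT points of $\mathrm{P}(0)$. For $\hat x\in\mathbb R^n$, the convex subproblem $\mathrm{P}_{\mathrm{cvx}}(\hat x;0)$ is: $\min_x c^Tx$ subject to $g'(\hat x)(x-\hat x)+g(\hat x)=0$, $x\in\Omega$. With $$\hat\varphi(z;\hat x):=\begin{pmatrix}c+g'(\hat x)^T\lambda\\ g(\hat x)+g'(\hat x)(x-\hat x)\end{pmatrix},$$ a pair $z=(x,\lambda)$ is a KKT point of $\mathrm{P}_{\mathrm{cvx}}(\hat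 x;0)$ if $0\in\hat\varphi(z;\hat x)+N_K(z)$. Full-step sequential convex programming (SCP): starting from $x^0\in\Omega$, for $j=0,1,2,\dots$ solve $\mathrm{P}_{\mathrm{cvx}}(x^j;0)$ to obtain $x^{j+1}$ (with multiplier $\lambda^{j+1}$). For the given KKT point $\bar z=(\bar x,\bar\lambda)$, define the set-valued mapping $L(z):=\hat\varphi(z;\bar x)+N_K(z)$ and its inverse $L^{-1}(\delta):=\{z\in\mathbb R^{n+m}:\delta\in L(z)\}$ for $\delta\in\mathbb R^{n+m}$. *)

(* Defs.v *)
From HB Require Import structures.
From mathcomp Require Import all_boot all_order all_algebra.
From mathcomp Require Import boolp classical_sets reals topology normedtype.
From mathcomp Require Import derive convex.

Set Implicit Arguments.
Unset Strict Implicit.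
Unset Printing Implicit Defensive.

Import Order.TTheory GRing.Theory Num.Theory.
Import numFieldNormedType.Exports.

Local Open Scope classical_set_scope.
Local Open Scope ring_scope.

(* Vectors of R^k are row vectors, as the library's Jacobian ['J g x] acts on  *)
(* row vectors from the right.  A pair z = (x, lambda) in R^n x R^m is the     *)
(* element [row_mx x lambda] of ['rV_(n + m)].                                 *)
Section Defs.
Context {R : realType}.

(* The norm [`|u|] of the library is the sup norm, which induces the same      *)
(* topology; quantitative bounds are stated with the norms below.              *)
Definition dotp {k : nat} (u v : 'rV[R]_k) : R := \sum_(i < k) u 0 i * v 0 i.

Definition norm2 {k : nat} (u : 'rV[R]_k) : R := Num.sqrt (dotp u u).

Definition normF {p q : nat} (A : 'M[R]_(p, q)) : R :=
  Num.sqrt (\sum_(i < p) \sum_(j < q) A i j ^+ 2).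

Section Smooth.
Context {n m : nat}.

(* g'(x); its (i, j) entry is the partial derivative of g_i along the j-th     *)
(* basis vector.                                                               *)
Definition jac (g : 'rV[R]_n -> 'rV[R]_m) (x : 'rV[R]_n) : 'M[R]_(m, n) :=
  (jacobian g x)^T.

(* C^2 in the Frechet sense.  Continuity of the second differential is stated  *)
(* pointwise in the direction v, equivalent to continuity in operator norm     *)
(* since the dimension is finite.                                              *)
Definition twice_continuously_differentiable (g : 'rV[R]_n -> 'rV[R]_m) :=
  [/\ forall x, differentiable g x,
      forall x, differentiable (jac g) x &
      forall v, continuous (fun x => 'd (jac g) x v)].

Definition hessian (f : 'rV[R]_n -> R) (x : 'rV[R]_n) : 'M[R]_n :=
  \matrix_(j < n, k < n)
    'D_(delta_mx 0 j) (fun y => 'D_(delta_mx 0 k) f y) x.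

End Smooth.

Definition normal_cone {k : nat} (C : set 'rV[R]_k) (x : 'rV[R]_k) :
    set 'rV[R]_k :=
  [set u | C x /\ forall v, C v -> dotp u (v - x) <= 0].

Section SCP.
Context {n m : nat}.
Variables (c : 'rV[R]_n) (g : 'rV[R]_n -> 'rV[R]_m) (Omega : set 'rV[R]_n).

Definition xpart (z : 'rV[R]_(n + m)) : 'rV[R]_n := lsubmx z.
Definition lpart (z : 'rV[R]_(n + m)) : 'rV[R]_m := rsubmx z.

Definition Kset : set 'rV[R]_(n + m) := [set z | Omega (xpart z)].

(* In row form, [lpart z *m jac g x] is the transpose of g'(x)^T lambda.       *)
Definition KKT : set 'rV[R]_(n + m) :=
  [set z | [set c + lpart z *m jac g (xpart z) + u
             | u in normal_cone Omega (xpart z)] 0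
           /\ g (xpart z) = 0].

Definition phihat (z : 'rV[R]_(n + m)) (xh : 'rV[R]_n) : 'rV[R]_(n + m) :=
  row_mx (c + lpart z *m jac g xh)
         (g xh + (xpart z - xh) *m (jac g xh)^T).

(* The set phihat(z; xh) + N_K(z). *)
Definition Lmap (xh : 'rV[R]_n) (z : 'rV[R]_(n + m)) : set 'rV[R]_(n + m) :=
  [set phihat z xh + u | u in normal_cone Kset z].

Definition Linv (xh : 'rV[R]_n) (delta : 'rV[R]_(n + m)) :
    set 'rV[R]_(n + m) :=
  [set z | Lmap xh z delta].

Definition KKTcvx (xh : 'rV[R]_n) : set 'rV[R]_(n + m) :=
  [set z | Lmap xh z 0].

Definition scp_sequence (z : nat -> 'rV[R]_(n + m)) : Prop :=
  Omega (xpart (z 0%N)) /\ forall j : nat, KKTcvx (xpart (z j)) (z j.+1).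

Definition E_g (z : 'rV[R]_(n + m)) : 'M[R]_n :=
  \sum_(i < m) lpart z 0 i *: hessian (fun y => g y 0 i) (xpart z).

End SCP.

Definition single_valued_on {p q : nat} (D : set 'rV[R]_p)
    (psi : 'rV[R]_p -> set 'rV[R]_q) : Prop :=
  forall d, D d -> exists! z, psi d z.

Definition lipschitz_on_set {p q : nat} (gamma : R) (D : set 'rV[R]_p)
    (psi : 'rV[R]_p -> set 'rV[R]_q) : Prop :=
  forall d d' z z', D d -> D d' -> psi d z -> psi d' z' ->
    norm2 (z - z') <= gamma * norm2 (d - d').

Definition converges_linearly {k : nat} (z : nat -> 'rV[R]_k)
    (zbar : 'rV[R]_k) : Prop :=
  z @ \oo --> zbar /\
  exists omega : R, [/\ 0 < omega, omega < 1 &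
    \forall j \near \oo, norm2 (z j.+1 - zbar) <= omega * norm2 (z j - zbar)].

End Defs.

(* Main.v *)
Require Import Defs.
From HB Require Import structures.
From mathcomp Require Import all_boot all_order all_algebra.
From mathcomp Require Import boolp classical_sets reals topology normedtype.
From mathcomp Require Import derive convex.
From mathcomp Require Import landau sequences.
From mathcomp Require Import ring lra.
Import Order.TTheory GRing.Theory Num.Theory.
Import numFieldNormedType.Exports.
Local Open Scope classical_set_scope.
Local Open Scope ring_scope.

(** Write xb for the primal part of zbar and J(x) for the Jacobian of g at x.
The subproblem at a nearby point x is the subproblem at xb perturbed by the
residual phihat(z; xb) - phihat(z; x): if z' is a KKT point of the subproblem
at x, then this residual, taken at z', lies in L(z'), so z' is an element of
L^-1 at a small argument.  The residual splits into its value a at zbar and a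
part linear in w = z' - zbar ([phihat_error_split]).

- The linear part is J(x) - J(xb) acting on w, hence at most 2 e |w| with e
  arbitrarily small for x close to xb ([norm2_skew_error]).
- The part a is an expansion error.  Its first component is, up to sign,
  lambda_bar (J(x) - J(xb)), which is (x - xb) E_g(zbar) up to o(|x - xb|),
  because contracting the differential of J with lambda_bar gives E_g
  ([mulmx_diff_jac]); its second component is o(|x - xb|).  Hence |a| is at
  most (kappa + 3 e) |x - xb| ([norm2_base_error]).

If z' lies in the region where L^-1 is the Lipschitz map psi, comparing z' with
zbar = psi(0) yields |w| <= gamma (kappa + 3 e) |x - xb| + 2 gamma e |w|, and
gamma kappa < 1 makes this a contraction with factor
gamma (kappa + 3 e) / (1 - 2 gamma e).

The remaining point is that nothing selects, among the KKT points of the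
subproblem, one close to zbar: every KKT point has to be close to zbar.  This
is a consequence of monotonicity.  After changing the sign of the constraint
component, L is a monotone map ([monotone_Lmap]), and the linear part of the
residual becomes orthogonal to w ([dotp_skew_error]).  Testing monotonicity
between z' and psi(d), for d of fixed small length r in the direction of w,
bounds |w| by a multiple of r, however far z' might have been
([monotone_localization]). *)

(** * Euclidean and Frobenius norms *)

Section Euclidean.
Context {R : realType}.

Lemma dotpC {k : nat} (u v : 'rV[R]_k) : dotp u v = dotp v u.
Proof. by apply: eq_bigr => i _; rewrite mulrC. Qed.

Lemma dotpDl {k : nat} (u v w : 'rV[R]_k) : dotp (u + v) w = dotp u w + dotp v w.
Proof. by rewrite -big_split; apply: eq_bigr => i _; rewrite !mxE mulrDl. Qed.

Lemma dotpZl {k : nat} a (u w : 'rV[R]_k) : dotp (a *: u) w = a * dotp u w.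
Proof. by rewrite big_distrr; apply: eq_bigr => i _; rewrite !mxE -mulrA. Qed.

Lemma dotpNl {k : nat} (u w : 'rV[R]_k) : dotp (- u) w = - dotp u w.
Proof. by rewrite -scaleN1r dotpZl mulN1r. Qed.

Lemma dotpBl {k : nat} (u v w : 'rV[R]_k) : dotp (u - v) w = dotp u w - dotp v w.
Proof. by rewrite dotpDl dotpNl. Qed.

Lemma dotpDr {k : nat} (u v w : 'rV[R]_k) : dotp w (u + v) = dotp w u + dotp w v.
Proof. by rewrite dotpC dotpDl !(dotpC w). Qed.

Lemma dotpZr {k : nat} a (u w : 'rV[R]_k) : dotp w (a *: u) = a * dotp w u.
Proof. by rewrite dotpC dotpZl (dotpC w). Qed.

Lemma dotpNr {k : nat} (u w : 'rV[R]_k) : dotp w (- u) = - dotp w u.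
Proof. by rewrite dotpC dotpNl (dotpC w). Qed.

Lemma dotp_mulmx {p q : nat} (u : 'rV[R]_p) (A : 'M[R]_(p, q)) (v : 'rV[R]_q) :
  dotp (u *m A) v = dotp u (v *m A^T).
Proof.
rewrite /dotp; under eq_bigr do rewrite mxE big_distrl.
rewrite exchange_big; apply: eq_bigr => i _.
rewrite mxE big_distrr; apply: eq_bigr => j _ /=.
by rewrite !mxE; ring.
Qed.

Lemma dotp_row_mx {p q : nat} (a a' : 'rV[R]_p) (b b' : 'rV[R]_q) :
  dotp (row_mx a b) (row_mx a' b') = dotp a a' + dotp b b'.
Proof.
rewrite /dotp big_split_ord; congr (_ + _); apply: eq_bigr => i _.
  by rewrite !row_mxEl.
by rewrite !row_mxEr.
Qed.

Lemma dotp_ge0 {k : nat} (u : 'rV[R]_k) : 0 <= dotp u u.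
Proof. by apply: sumr_ge0 => i _; rewrite -expr2 sqr_ge0. Qed.

Lemma norm2_ge0 {k : nat} (u : 'rV[R]_k) : 0 <= norm2 u.
Proof. exact: sqrtr_ge0. Qed.

Lemma sqr_norm2 {k : nat} (u : 'rV[R]_k) : norm2 u ^+ 2 = dotp u u.
Proof. by rewrite sqr_sqrtr ?dotp_ge0. Qed.

Lemma norm2_eq0 {k : nat} (u : 'rV[R]_k) : norm2 u = 0 -> u = 0.
Proof.
move=> /(congr1 (fun t => t ^+ 2)); rewrite sqr_norm2 expr0n /= => /eqP.
rewrite psumr_eq0 => [/allP u0|i _]; last by rewrite -expr2 sqr_ge0.
apply/rowP => i; have := u0 i (mem_index_enum i).
by rewrite -expr2 sqrf_eq0 !mxE => /eqP.
Qed.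

Lemma norm2N {k : nat} (u : 'rV[R]_k) : norm2 (- u) = norm2 u.
Proof. by rewrite /norm2 dotpNl dotpNr opprK. Qed.

Lemma norm2B {k : nat} (u v : 'rV[R]_k) : norm2 (u - v) = norm2 (v - u).
Proof. by rewrite -norm2N opprB. Qed.

Lemma norm2_0 {k : nat} : norm2 (0 : 'rV[R]_k) = 0.
Proof. by rewrite /norm2 /dotp big1 ?sqrtr0// => i _; rewrite mxE mul0r. Qed.

Lemma norm2Z {k : nat} a (u : 'rV[R]_k) : 0 <= a -> norm2 (a *: u) = a * norm2 u.
Proof.
move=> a0; rewrite /norm2 dotpZl dotpZr mulrA sqrtrM ?mulr_ge0//.
by rewrite -expr2 sqrtr_sqr ger0_norm.
Qed.

(** Cauchy-Schwarz: the vector (v.v) u - (u.v) v has nonnegative square. *)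
Lemma dotp_sqr_le {k : nat} (u v : 'rV[R]_k) :
  dotp u v ^+ 2 <= dotp u u * dotp v v.
Proof.
have [v0|v_neq0] := eqVneq (norm2 v) 0.
  rewrite (norm2_eq0 v v0) {1}/dotp big1 ?expr0n ?mulr_ge0 ?dotp_ge0//.
  by move=> i _; rewrite mxE mulr0.
have v_gt0 : 0 < dotp v v.
  by rewrite -sqr_norm2 exprn_gt0// lt_neqAle eq_sym v_neq0 norm2_ge0.
have := dotp_ge0 (dotp v v *: u - dotp u v *: v).
rewrite dotpBl !dotpZl !(dotpDr _ (- _)) !dotpNr !dotpZr (dotpC v u) => H.
rewrite -subr_ge0 -(pmulr_rge0 _ v_gt0).
by apply: le_trans H _; rewrite le_eqVlt; apply/orP; left; apply/eqP; ring.
Qed.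

Lemma dotp_le_norm2 {k : nat} (u v : 'rV[R]_k) : dotp u v <= norm2 u * norm2 v.
Proof.
apply: le_trans (ler_norm _) _.
rewrite -(@ler_pXn2r _ 2)// ?nnegrE ?mulr_ge0 ?norm2_ge0//.
by rewrite exprMn !sqr_norm2 real_normK ?num_real// dotp_sqr_le.
Qed.

Lemma norm2D_le {k : nat} (u v : 'rV[R]_k) : norm2 (u + v) <= norm2 u + norm2 v.
Proof.
rewrite -(@ler_pXn2r _ 2)// ?nnegrE ?addr_ge0 ?norm2_ge0//.
rewrite sqrrD !sqr_norm2 dotpDl !dotpDr (dotpC v u).
have := dotp_le_norm2 u v; lra.
Qed.

Lemma norm2_normF {k : nat} (u : 'rV[R]_k) : norm2 u = normF u.
Proof. by rewrite /norm2 /normF big_ord1. Qed.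

Lemma normF_ge0 {p q : nat} (A : 'M[R]_(p, q)) : 0 <= normF A.
Proof. exact: sqrtr_ge0. Qed.

Lemma sqr_normF {p q : nat} (A : 'M[R]_(p, q)) :
  normF A ^+ 2 = \sum_(i < p) \sum_(j < q) A i j ^+ 2.
Proof.
by rewrite sqr_sqrtr//; do 2!(apply: sumr_ge0 => ? _); rewrite sqr_ge0.
Qed.

Lemma normF_trmx {p q : nat} (A : 'M[R]_(p, q)) : normF A^T = normF A.
Proof.
rewrite /normF exchange_big; congr (Num.sqrt _).
by do 2!(apply: eq_bigr => ? _); rewrite mxE.
Qed.

(** Cauchy-Schwarz against each column of A. *)
Lemma norm2_mulmx_le {p q : nat} (u : 'rV[R]_p) (A : 'M[R]_(p, q)) :
  norm2 (u *m A) <= norm2 u * normF A.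
Proof.
rewrite -(@ler_pXn2r _ 2)// ?nnegrE ?mulr_ge0 ?norm2_ge0 ?normF_ge0//.
rewrite exprMn !sqr_norm2 sqr_normF exchange_big big_distrr; apply: ler_sum => j _ /=.
rewrite -expr2 (_ : (u *m A) 0 j = dotp u (col j A)^T).
  apply: le_trans (dotp_sqr_le _ _) _; rewrite le_eqVlt; apply/orP; left.
  by apply/eqP; congr (_ * _); apply: eq_bigr => i _; rewrite !mxE expr2.
by rewrite mxE; apply: eq_bigr => i _; rewrite !mxE.
Qed.

Lemma norm_le_normF {p q : nat} (A : 'M[R]_(p, q)) : `|A| <= normF A.
Proof.
rewrite [leLHS]/Num.Def.normr /= mx_normrE.
apply: bigmax_le => [|[i j] _ /=]; first exact: normF_ge0.
rewrite -(@ler_pXn2r _ 2)// ?nnegrE ?normF_ge0//.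
rewrite sqr_normF real_normK ?num_real// (bigD1 i)//= (bigD1 j)//= -addrA.
rewrite lerDl addr_ge0//; first by apply: sumr_ge0 => ? _; rewrite sqr_ge0.
by do 2!(apply: sumr_ge0 => ? _); rewrite sqr_ge0.
Qed.

Lemma normF_le_norm {p q : nat} (A : 'M[R]_(p, q)) :
  normF A <= (p * q)%:R * `|A|.
Proof.
rewrite -(@ler_pXn2r _ 2)// ?nnegrE ?normF_ge0 ?mulr_ge0//.
rewrite sqr_normF.
have le_entry i j : A i j ^+ 2 <= `|A| ^+ 2.
  rewrite -[leLHS]real_normK ?num_real// ler_pXn2r ?nnegrE//.
  by rewrite [leRHS]/Num.Def.normr /= mx_normrE; exact: (le_bigmax _ _ (i, j)).
apply: (@le_trans _ _ (\sum_(i < p) \sum_(j < q) `|A| ^+ 2)).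
  by do 2!(apply: ler_sum => ? _).
rewrite !sumr_const !card_ord -mulrnA -[leLHS]mulr_natl exprMn mulnC.
apply: ler_wpM2r; first exact: exprn_ge0.
by rewrite -natrX ler_nat; case: (p * q)%N => // k; rewrite -{1}(expn1 k.+1) leq_pexp2l.
Qed.

(** The topology comes from the sup norm, to which the Euclidean norm is
equivalent in finite dimension. *)
Lemma nbhs_norm2P {k : nat} (x : 'rV[R]_k) (N : set 'rV[R]_k) :
  nbhs x N <-> exists2 r : R, 0 < r & forall y, norm2 (y - x) < r -> N y.
Proof.
split=> [/(nbhs_normP x N)[r /= r0 Nr]|[r r0 Nr]].
  exists r => // y yx; apply: Nr => /=.
  by rewrite distrC (le_lt_trans (norm_le_normF _))// -norm2_normF.
(* 1 * k is the constant of normF_le_norm; adding 1 covers the case k = 0. *)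
apply/(nbhs_normP x N); exists (r / (1 * k).+1%:R) => /=; first by rewrite divr_gt0.
move=> y /=; rewrite distrC ltr_pdivlMr// => yx; apply: Nr.
rewrite norm2_normF (le_lt_trans (normF_le_norm _))// (le_lt_trans _ yx)//.
by rewrite mulrC ler_wpM2l// ler_nat.
Qed.

Lemma norm2_row_mx_le {p q : nat} (a : 'rV[R]_p) (b : 'rV[R]_q) :
  norm2 (row_mx a b) <= norm2 a + norm2 b.
Proof.
rewrite -(@ler_pXn2r _ 2)// ?nnegrE ?addr_ge0 ?norm2_ge0//.
rewrite sqrrD !sqr_norm2 dotp_row_mx.
have := mulr_ge0 (norm2_ge0 a) (norm2_ge0 b); lra.
Qed.

Lemma norm2_lsubmx_le {p q : nat} (z : 'rV[R]_(p + q)) :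
  norm2 (lsubmx z) <= norm2 z.
Proof.
rewrite -(@ler_pXn2r _ 2)// ?nnegrE ?norm2_ge0// !sqr_norm2.
by rewrite -[in leRHS](hsubmxK z) dotp_row_mx lerDl dotp_ge0.
Qed.

Lemma norm2_rsubmx_le {p q : nat} (z : 'rV[R]_(p + q)) :
  norm2 (rsubmx z) <= norm2 z.
Proof.
rewrite -(@ler_pXn2r _ 2)// ?nnegrE ?norm2_ge0// !sqr_norm2.
by rewrite -[in leRHS](hsubmxK z) dotp_row_mx lerDr dotp_ge0.
Qed.

End Euclidean.

(** * First-order expansions and the Hessian of the Lagrangian *)

Section Smoothness.
Context {R : realType} {n : nat}.

Lemma differentiable_normF_le {p q : nat} (f : 'rV[R]_n -> 'M[R]_(p, q)) (x0 : 'rV[R]_n) :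
  differentiable f x0 -> forall e : R, 0 < e ->
  \forall x \near x0, normF (f x - f x0 - 'd f x0 (x - x0)) <= e * norm2 (x - x0).
Proof.
move=> df e e0.
(* K is a comparison constant of the two norms, kept positive for empty matrices. *)
set K : R := (p * q)%:R + 1.
have K0 : 0 < K by rewrite ltr_wpDl.
have eK0 : 0 < e / K by rewrite divr_gt0.
have := diff_locallyx df; set w := the_littleo _ _ _ _ _ => fw.
have w_small : \forall h \near (0 : 'rV[R]_n), `|w h| <= e / K * `|h|.
  exact: (littleoP [littleo of w] eK0).
have /nbhs_norm0P[r /= r0 Hr] := w_small.
apply/(nbhs_normP x0 _); exists r => //= x /=; rewrite distrC => xr.
have -> : f x - f x0 - 'd f x0 (x - x0) = w (x - x0).
  have -> : f x = f x0 + 'd f x0 (x - x0) + w (x - x0) by rewrite -fw subrK.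
  by rewrite -addrA -opprD addrAC subrr add0r.
have {Hr} H := Hr _ xr.
apply: le_trans (normF_le_norm _) _.
apply: (@le_trans _ _ (K * (e / K * `|x - x0|))).
  by apply: ler_pM => //; rewrite lerDl.
rewrite !mulrA [K * e]mulrC mulfK ?gt_eqF// ler_wpM2l ?(ltW e0)//.
by rewrite norm2_normF norm_le_normF.
Qed.

Lemma continuous_normF_le {p q : nat} (f : 'rV[R]_n -> 'M[R]_(p, q)) (x0 : 'rV[R]_n) :
  {for x0, continuous f} -> forall e : R, 0 < e ->
  \forall x \near x0, normF (f x - f x0) <= e.
Proof.
move=> cf e e0; set K : R := (p * q)%:R + 1.
have K0 : 0 < K by rewrite ltr_wpDl.
have eK0 : 0 < e / K by rewrite divr_gt0.
move/cvgrPdist_le : cf => /(_ _ eK0); apply: filterS => x /=; rewrite distrC => H.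
apply: le_trans (normF_le_norm _) _.
apply: (@le_trans _ _ (K * (e / K))); last by rewrite mulrCA mulfV ?gt_eqF ?mulr1.
by apply: ler_pM => //; rewrite lerDl.
Qed.

Lemma jacE {m : nat} (g : 'rV[R]_n -> 'rV[R]_m) x i k : differentiable g x ->
  jac g x i k = 'D_(delta_mx 0 k) (fun y => g y 0 i) x.
Proof.
move=> dg; rewrite !mxE.
by rewrite -deriveE// derive_mx ?mxE//; exact: diff_derivable.
Qed.

Lemma mulmx_jac {m : nat} (g : 'rV[R]_n -> 'rV[R]_m) x h :
  h *m (jac g x)^T = 'd g x h.
Proof. by rewrite trmxK mul_rV_lin1. Qed.

(** The k-th entry of l dJ(x)h is the derivative along h of the sum over i of
l_i D_k g_i; expanding h in the standard basis produces the second partial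
derivatives, taken in the order of [hessian]. *)
Lemma mulmx_diff_jac {m : nat} (g : 'rV[R]_n -> 'rV[R]_m) (l : 'rV[R]_m) x h :
  (forall y, differentiable g y) -> differentiable (jac g) x ->
  l *m 'd (jac g) x h =
  h *m \sum_(i < m) l 0 i *: hessian (fun y => g y 0 i) x.
Proof.
move=> dg dJ.
have entry i k j : 'd (jac g) x (delta_mx 0 j) i k =
    hessian (fun y => g y 0 i) x j k.
  rewrite -deriveE// derive_mx; last exact: diff_derivable.
  rewrite [LHS]mxE [RHS]mxE.
  have -> // : (fun y => jac g y i k) =
      (fun y => 'D_(delta_mx 0 k) (fun y => g y 0 i) y).
  by apply/funext => y; rewrite jacE.
apply/rowP => k; rewrite [h in LHS]row_sum_delta [LHS]mxE [RHS]mxE.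
under [RHS]eq_bigr do rewrite summxE big_distrr.
rewrite exchange_big; apply: eq_bigr => i _ /=.
rewrite linear_sum summxE big_distrr /=; apply: eq_bigr => j _.
rewrite linearZ [in LHS]mxE entry [in RHS]mxE.
by rewrite mulrCA.
Qed.

End Smoothness.

(** * Localization of solutions of monotone inclusions *)

Section Localization.
Context {R : realType} {k : nat}.

Definition monotone_map (T : 'rV[R]_k -> set 'rV[R]_k) :=
  forall z z' d d', T z d -> T z' d' -> 0 <= dotp (d - d') (z - z').

(** A map T that is monotone and has near zbar a preimage of every small d
cannot have, far from zbar, a solution of an inclusion perturbed by a small
constant a and a term s orthogonal to z - zbar.  With w = z - zbar and
d = r w / |w|, monotonicity between z and the preimage y of d reads
r |w| <= a.w + (a + s - d).(zbar - y), the product s.w being zero.  Since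
|zbar - y| <= gamma r, the right-hand side is at most
r |w| / 2 + 5/4 gamma r^2. *)
Lemma monotone_localization (T : 'rV[R]_k -> set 'rV[R]_k)
    (zbar z a s : 'rV[R]_k) (gamma r e : R) :
  monotone_map T -> 0 < gamma -> 0 < r ->
  (forall d, norm2 d <= r ->
     exists2 y, T y d & norm2 (y - zbar) <= gamma * norm2 d) ->
  T z (a + s) ->
  dotp s (z - zbar) = 0 -> norm2 s <= e * norm2 (z - zbar) ->
  norm2 a <= r / 4 -> e * gamma <= 1 / 4 ->
  norm2 (z - zbar) <= 3 * gamma * r.
Proof.
move=> Tmono gamma0 r0 Tinv Tz s_orth s_le a_le e_le.
have ga0 : 0 < gamma * r by exact: mulr_gt0.
set D := norm2 (z - zbar) in s_le *.
have [D0|D_neq0] := eqVneq D 0; first by rewrite D0; lra.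
have D_gt0 : 0 < D by rewrite lt_neqAle eq_sym D_neq0 norm2_ge0.
pose d := (r / D) *: (z - zbar).
have d_norm : norm2 d = r.
  by rewrite norm2Z ?divr_ge0 ?(ltW r0) ?norm2_ge0// -/D divfK.
have [y Ty y_le] : exists2 y, T y d & norm2 (y - zbar) <= gamma * norm2 d.
  by apply: Tinv; rewrite d_norm.
have := Tmono _ _ _ _ Tz Ty.
rewrite d_norm norm2B in y_le.
rewrite (_ : z - y = (z - zbar) + (zbar - y)); last by rewrite addrA subrK.
rewrite dotpBl dotpDl !(dotpDr (z - zbar)) s_orth add0r.
rewrite [dotp d (z - zbar)]dotpZl -sqr_norm2 -/D.
rewrite (_ : r / D * D ^+ 2 = r * D); last by rewrite expr2 mulrA divfK.
have h1 : dotp a (z - zbar) <= r / 4 * D.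
  by apply: le_trans (dotp_le_norm2 _ _) _; rewrite ler_wpM2r ?norm2_ge0.
have h2 : dotp a (zbar - y) <= r / 4 * (gamma * r).
  by apply: le_trans (dotp_le_norm2 _ _) _; rewrite ler_pM ?norm2_ge0.
have h3 : dotp s (zbar - y) <= e * D * (gamma * r).
  by apply: le_trans (dotp_le_norm2 _ _) _; rewrite ler_pM ?norm2_ge0.
have h4 : - dotp d (zbar - y) <= r * (gamma * r).
  rewrite -dotpNl; apply: le_trans (dotp_le_norm2 _ _) _.
  by rewrite norm2N d_norm ler_wpM2l ?(ltW r0).
have h5 : e * D * (gamma * r) <= 1 / 4 * (D * r).
  rewrite (_ : _ * _ = e * gamma * (D * r)); last by ring.
  by rewrite ler_wpM2r ?mulr_ge0 ?(ltW r0) ?(ltW D_gt0).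
move=> H.
have : r * D <= r * (5 / 2 * (gamma * r)) by lra.
rewrite ler_pM2l//; lra.
Qed.

End Localization.

(** * The linearized KKT system *)

Lemma affine_error_split {R : realType} {p q : nat} (b b' : 'rV[R]_q)
    (a a' u v : 'rV[R]_p) (A A' : 'M[R]_(p, q)) :
  b + (u - a) *m A - (b' + (u - a') *m A') =
  b + (v - a) *m A - (b' + (v - a') *m A') - (u - v) *m (A' - A).
Proof.
rewrite !mulmxBl !mulmxBr.
move: (u *m A) (u *m A') (v *m A) (v *m A') (a *m A) (a' *m A').
by move=> B C D E F G; apply/rowP => i; rewrite !mxE; ring.
Qed.

Lemma affine_error_at_center_l {R : realType} {p q : nat} (b : 'rV[R]_q)
    (u : 'rV[R]_p) (A A' : 'M[R]_(p, q)) :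
  b + u *m A - (b + u *m A') = - (u *m (A' - A)).
Proof. by rewrite mulmxBr opprB opprD addrACA subrr add0r. Qed.

Lemma affine_error_at_center_x {R : realType} {p q : nat} (b b' : 'rV[R]_q)
    (a u : 'rV[R]_p) (A A' : 'M[R]_(p, q)) :
  b + (u - u) *m A - (b' + (u - a) *m A') =
  - (b' - b - (a - u) *m A - (a - u) *m (A' - A)).
Proof.
rewrite !mulmxBr !mulmxBl.
move: (u *m A) (u *m A') (a *m A) (a *m A') => B C D E.
by apply/rowP => i; rewrite !mxE; ring.
Qed.

Section Subproblems.
Context {R : realType} {n m : nat}.
Variables (c : 'rV[R]_n) (g : 'rV[R]_n -> 'rV[R]_m) (Omega : set 'rV[R]_n).

(** The linearized KKT map has the blocks J^T and J off the diagonal; changing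
the sign of one component makes its linear part skew, hence monotone. *)
Definition flip (z : 'rV[R]_(n + m)) : 'rV[R]_(n + m) :=
  row_mx (xpart z) (- lpart z).

Lemma xpartD (u v : 'rV[R]_(n + m)) : xpart (u + v) = xpart u + xpart v.
Proof. exact: linearD. Qed.

Lemma lpartD (u v : 'rV[R]_(n + m)) : lpart (u + v) = lpart u + lpart v.
Proof. exact: linearD. Qed.

Lemma xpartB (u v : 'rV[R]_(n + m)) : xpart (u - v) = xpart u - xpart v.
Proof. exact: linearB. Qed.

Lemma lpartB (u v : 'rV[R]_(n + m)) : lpart (u - v) = lpart u - lpart v.
Proof. exact: linearB. Qed.

Lemma xpart_phihat z xh : xpart (phihat c g z xh) = c + lpart z *m jac g xh.
Proof. exact: row_mxKl. Qed.

Lemma lpart_phihat z xh :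
  lpart (phihat c g z xh) = g xh + (xpart z - xh) *m (jac g xh)^T.
Proof. exact: row_mxKr. Qed.

Lemma flipK : involutive flip.
Proof.
by move=> z; rewrite {1}/flip /xpart /lpart row_mxKl row_mxKr opprK hsubmxK.
Qed.

Lemma flipD u v : flip (u + v) = flip u + flip v.
Proof. by rewrite /flip /xpart /lpart !linearD add_row_mx. Qed.

Lemma flipB u v : flip (u - v) = flip u - flip v.
Proof. by rewrite /flip /xpart /lpart !linearB opp_row_mx add_row_mx. Qed.

Lemma dotp_flip u v : dotp (flip u) v =
  dotp (xpart u) (xpart v) - dotp (lpart u) (lpart v).
Proof. by rewrite -[v in LHS]hsubmxK dotp_row_mx dotpNl. Qed.

Lemma dotp_flip_flip u v : dotp (flip u) (flip v) = dotp u v.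
Proof. by rewrite dotp_row_mx dotpNl dotpNr opprK -dotp_row_mx !hsubmxK. Qed.

Lemma norm2_flip u : norm2 (flip u) = norm2 u.
Proof. by rewrite /norm2 dotp_flip_flip. Qed.

(** Multipliers are unconstrained, so z + (0, lpart u) is a test point for the
normal u; it gives |lpart u|^2 <= 0. *)
Lemma normal_cone_lpart (z u : 'rV[R]_(n + m)) :
  normal_cone (Kset Omega) z u -> lpart u = 0.
Proof.
move=> [Kz uK].
have : dotp u (row_mx (xpart z) (lpart z + lpart u) - z) <= 0.
  by apply: uK; rewrite /Kset /= /xpart row_mxKl.
rewrite -[z in _ - z]hsubmxK opp_row_mx add_row_mx subrr addrAC subrr add0r.
rewrite -[u in dotp u]hsubmxK dotp_row_mx /dotp.
rewrite (_ : \sum_(i < n) _ = 0) ?add0r; last first.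
  by apply: big1 => i _; rewrite [(0 : 'rV_n) 0 i]mxE mulr0.
rewrite -/(dotp _ _) -sqr_norm2 => H; apply: norm2_eq0.
by apply/eqP; rewrite -sqrf_eq0 eq_le H sqr_ge0.
Qed.

Lemma normal_cone_xpart (z u v : 'rV[R]_(n + m)) : normal_cone (Kset Omega) z u ->
  Omega (xpart v) -> dotp (xpart u) (xpart (v - z)) <= 0.
Proof.
move=> Nu Ov; have l0 := normal_cone_lpart z u Nu; have [_ uK] := Nu.
suff -> : dotp (xpart u) (xpart (v - z)) = dotp u (v - z) by exact: uK.
rewrite -[u in RHS]hsubmxK -[v - z in RHS]hsubmxK dotp_row_mx -/(lpart u) l0.
by rewrite [dotp 0 _]big1 ?addr0// => i _; rewrite mxE mul0r.
Qed.

(** The bilinear terms in J cancel between the two components, which leaves the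
monotonicity of the normal cone of Omega. *)
Lemma monotone_Lmap xh : monotone_map (fun z d => Lmap c g Omega xh z (flip d)).
Proof.
move=> z z' d d' [u Nu du] [u' Nu' du'].
rewrite -[d](flipK) -[d']flipK -du -du' -flipB dotp_flip.
have K0 := normal_cone_xpart z u z' Nu Nu'.1.
have K1 := normal_cone_xpart z' u' z Nu' Nu.1.
have L0 := normal_cone_lpart z u Nu; have L1 := normal_cone_lpart z' u' Nu'.
set w := z - z'.
have -> : xpart (phihat c g z xh + u - (phihat c g z' xh + u')) =
    lpart w *m jac g xh + (xpart u - xpart u').
  rewrite /w !xpartB !lpartB !xpartD !xpart_phihat mulmxBl.
  move: (_ *m _) (_ *m _) => A B.
  by apply/rowP => i; rewrite !mxE; ring.
have -> : lpart (phihat c g z xh + u - (phihat c g z' xh + u')) =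
    xpart w *m (jac g xh)^T.
  rewrite /w lpartB xpartB !lpartD L0 L1 !lpart_phihat !addr0 !mulmxBl.
  move: (_ *m _) (_ *m _) (_ *m _) => A B C.
  by apply/rowP => i; rewrite !mxE; ring.
rewrite dotpDl dotp_mulmx dotpC -addrAC subrr add0r dotpBl subr_ge0.
move: K0; rewrite -opprB -/w /xpart linearN dotpNr oppr_le0 => K0.
exact: le_trans K1 K0.
Qed.

Lemma Lmap_shift xh xb z d :
  Lmap c g Omega xh z d ->
  Lmap c g Omega xb z (d + (phihat c g z xb - phihat c g z xh)).
Proof.
move=> [u Nu <-]; exists u => //.
by rewrite [RHS]addrC addrA subrK.
Qed.

Lemma KKT_Lmap z : KKT c g Omega z -> Lmap c g Omega (xpart z) z 0.
Proof.
move=> [[u [Ox uN] cu] gz]; exists (row_mx u 0).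
  split=> // v Kv; rewrite -[v - z]hsubmxK dotp_row_mx.
  rewrite [X in _ + X]big1 ?addr0; last by move=> i _; rewrite mxE mul0r.
  by rewrite linearB; exact: uN.
by rewrite /phihat gz subrr mul0mx addr0 add_row_mx cu addr0 row_mx0.
Qed.

(** The residual phihat(z; xb) - phihat(z; x) is affine in z; this is its linear
part, J standing for the change J(x) - J(xb) of the Jacobian. *)
Definition skew_error (J : 'M[R]_(m, n)) (w : 'rV[R]_(n + m)) : 'rV[R]_(n + m) :=
  - row_mx (lpart w *m J) (xpart w *m J^T).

Lemma phihat_error_split xb xh z zb :
  phihat c g z xb - phihat c g z xh =
  (phihat c g zb xb - phihat c g zb xh)
  + skew_error (jac g xh - jac g xb) (z - zb).
Proof.
rewrite /skew_error /phihat !opp_row_mx !add_row_mx lpartB xpartB.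
congr row_mx; last by rewrite linearB; exact: affine_error_split.
have := affine_error_split c c 0 0 (lpart z) (lpart zb) (jac g xb) (jac g xh).
by rewrite !subr0.
Qed.

Lemma dotp_skew_error J w : dotp (skew_error J w) (flip w) = 0.
Proof.
rewrite dotpNl /flip dotp_row_mx dotpNr (dotpC _ (lpart w)) dotp_mulmx.
by rewrite (dotpC (lpart w)) subrr oppr0.
Qed.

Lemma norm2_skew_error J w e : normF J <= e ->
  norm2 (skew_error J w) <= 2 * e * norm2 w.
Proof.
move=> Je; rewrite norm2N; apply: le_trans (norm2_row_mx_le _ _) _.
have h1 : norm2 (lpart w *m J) <= norm2 w * e.
  apply: le_trans (norm2_mulmx_le _ _) _.
  by rewrite ler_pM ?norm2_ge0 ?normF_ge0 ?norm2_rsubmx_le.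
have h2 : norm2 (xpart w *m J^T) <= norm2 w * e.
  apply: le_trans (norm2_mulmx_le _ _) _.
  by rewrite normF_trmx ler_pM ?norm2_ge0 ?normF_ge0 ?norm2_lsubmx_le.
lra.
Qed.

(** The value of the residual at zbar is, up to sign, the expansion error of J
at xb contracted with the multiplier, plus (x - xb) E_g, in the first
component, and in the second the expansion error of g minus (J(x) - J(xb))
applied to x - xb.  Each of the three terms other than (x - xb) E_g is at most
e |x - xb| near xb. *)
Lemma norm2_base_error zbar e : twice_continuously_differentiable g -> 0 < e ->
  \forall x \near xpart zbar,
    normF (jac g x - jac g (xpart zbar)) <= e /\
    norm2 (phihat c g zbar (xpart zbar) - phihat c g zbar x)
      <= (normF (E_g g zbar) + 3 * e) * norm2 (x - xpart zbar).
Proof.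
move=> [dg dJ _] e0; set xb := xpart zbar.
set l := lpart zbar.
have l_ge0 : 0 <= norm2 l := norm2_ge0 l.
have l1 : 0 < norm2 l + 1 by rewrite ltr_wpDl.
have e1 : 0 < e / (norm2 l + 1) by rewrite divr_gt0.
have Jnear := continuous_normF_le (jac g) xb (differentiable_continuous (dJ xb)) e e0.
have dJnear := differentiable_normF_le (jac g) xb (dJ xb) _ e1.
have gnear := differentiable_normF_le g xb (dg xb) _ e0.
apply: filterS3 Jnear dJnear gnear => x.
set h := x - xb => Jx dJx gx; split=> //.
rewrite -norm2_normF -mulmx_jac in gx.
have -> : phihat c g zbar xb - phihat c g zbar x =
    - row_mx (l *m (jac g x - jac g xb - 'd (jac g) xb h) + h *m E_g g zbar)
        ((g x - g xb - h *m (jac g xb)^T) - h *m (jac g x - jac g xb)^T).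
  rewrite /phihat !opp_row_mx add_row_mx; congr row_mx.
    rewrite mulmxBr (mulmx_diff_jac g l xb h) // -/(E_g g zbar) subrK.
    exact: affine_error_at_center_l.
  by rewrite [(_ - _)^T]linearB; exact: affine_error_at_center_x.
rewrite norm2N; apply: le_trans (norm2_row_mx_le _ _) _.
have h1 : norm2 (l *m (jac g x - jac g xb - 'd (jac g) xb h)) <= e * norm2 h.
  apply: le_trans (norm2_mulmx_le _ _) _.
  apply: le_trans (ler_wpM2l l_ge0 dJx) _.
  rewrite mulrA ler_wpM2r ?norm2_ge0// mulrA ler_pdivrMr// mulrC.
  by rewrite ler_pM2l// lerDl.
have h2 : norm2 (h *m E_g g zbar) <= normF (E_g g zbar) * norm2 h.
  by rewrite mulrC norm2_mulmx_le.
have h3 : norm2 (- (h *m (jac g x - jac g xb)^T)) <= e * norm2 h.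
  rewrite norm2N; apply: le_trans (norm2_mulmx_le _ _) _.
  by rewrite normF_trmx mulrC ler_wpM2r ?norm2_ge0.
have h4 := norm2D_le (l *m (jac g x - jac g xb - 'd (jac g) xb h)) (h *m E_g g zbar).
have h5 := norm2D_le (g x - g xb - h *m (jac g xb)^T) (- (h *m (jac g x - jac g xb)^T)).
lra.
Qed.

End Subproblems.

(** * Linear convergence *)

Section LinearConvergence.
Context {R : realType} {k : nat}.

Lemma contraction_converges_linearly (z : nat -> 'rV[R]_k) (zbar : 'rV[R]_k) (w : R) :
  0 < w -> w < 1 ->
  (forall j, norm2 (z j.+1 - zbar) <= w * norm2 (z j - zbar)) ->
  converges_linearly z zbar.
Proof.
move=> w0 w1 zw; split; last by exists w; split => //; apply: nearW.
have geo j : norm2 (z j - zbar) <= norm2 (z 0%N - zbar) * w ^+ j.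
  elim: j => [|j IH]; first by rewrite expr0 mulr1.
  by apply: le_trans (zw j) _; rewrite exprS mulrCA ler_wpM2l// ltW.
have cgeo : norm2 (z 0%N - zbar) * w ^+ j @[j --> \oo] --> (0 : R).
  rewrite -[X in _ --> X](mulr0 (norm2 (z 0%N - zbar))).
  by apply: cvgMr; apply: cvg_expr; rewrite ger0_norm ?ltW.
apply/cvgrPdist_le => e e0.
move/cvgrPdist_le : cgeo => /(_ _ e0); apply: filterS => j /=.
rewrite sub0r normrN => H; rewrite distrC.
apply: le_trans (norm_le_normF _) _; rewrite -norm2_normF.
exact: le_trans (geo j) (le_trans (ler_norm _) H).
Qed.

End LinearConvergence.

Theorem corollary1 (R : realType) (n m : nat)
    (c : 'rV[R]_n) (g : 'rV[R]_n -> 'rV[R]_m) (Omega : set 'rV[R]_n)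
    (convex_Omega : @convex_set R 'rV[R]_n Omega)
    (zbar : 'rV[R]_(n + m)) (zbar_KKT : KKT c g Omega zbar)
    (A1 : KKT c g Omega !=set0)
    (A2 : twice_continuously_differentiable g)
    (N0 Nzbar : set 'rV[R]_(n + m)) (gamma : R)
    (nbhs_N0 : nbhs (0 : 'rV[R]_(n + m)) N0)
    (nbhs_Nzbar : nbhs zbar Nzbar)
    (gamma_gt0 : 0 < gamma)
    (A3_single : single_valued_on N0
       (fun delta => Nzbar `&` Linv c g Omega (xpart zbar) delta))
    (A3_lipschitz : lipschitz_on_set gamma N0
       (fun delta => Nzbar `&` Linv c g Omega (xpart zbar) delta))
    (kappa : R) (kappa_ge0 : 0 <= kappa) (kappa_lt : kappa < 1 / gamma)
    (A4 : normF (E_g g zbar) <= kappa) :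
  exists (Nrho : set 'rV[R]_(n + m)) (omega : R),
    [/\ nbhs zbar Nrho, 0 < omega, omega < 1 &
      forall z : nat -> 'rV[R]_(n + m),
        Nrho (z 0%N) -> scp_sequence c g Omega z ->
        (forall j : nat,
           norm2 (z j.+1 - zbar) <= omega * norm2 (z j - zbar)) /\
        converges_linearly z zbar].
Proof.
set xb := xpart zbar in A3_single A3_lipschitz *.
have gk_lt1 : gamma * kappa < 1 by rewrite mulrC -ltr_pdivlMr.
have gk_ge0 : 0 <= gamma * kappa by rewrite mulr_ge0// ltW.
(* omega < 1 amounts to gamma kappa + 5 gamma e < 1; this e spends half of the
   slack 1 - gamma kappa, and also gives 2 e gamma <= 1/4 for the localization. *)
pose e : R := (1 - gamma * kappa) / (10 * gamma).
have e_gt0 : 0 < e by rewrite divr_gt0 ?subr_gt0 ?mulr_gt0.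
have ge : gamma * e = (1 - gamma * kappa) / 10.
  by rewrite /e; field; rewrite gt_eqF.
pose omega : R := gamma * (kappa + 3 * e) / (1 - 2 * gamma * e).
have den_gt0 : 0 < 1 - 2 * gamma * e by lra.
have num_gt0 : 0 < kappa + 3 * e by lra.
have omega_gt0 : 0 < omega by rewrite !(divr_gt0, mulr_gt0).
have omega_lt1 : omega < 1 by rewrite ltr_pdivrMr// mul1r; lra.
have [r0 r0_gt0 ballN0] := (nbhs_norm2P _ _).1 nbhs_N0.
have [s s_gt0 ballNz] := (nbhs_norm2P _ _).1 nbhs_Nzbar.
(* r is the radius of the data perturbations; localization within 3 gamma r of
   zbar keeps the iterates in Nzbar. *)
pose r : R := Num.min (r0 / 2) (s / (4 * gamma)).
have r_gt0 : 0 < r by rewrite lt_min !divr_gt0 ?mulr_gt0.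
have rN0 d : norm2 d <= r -> N0 d.
  move=> dr; apply: ballN0; rewrite subr0; apply: le_lt_trans dr _.
  by rewrite gt_min ltr_pdivrMr// ltr_pMr// ltr1n.
have rNz : 3 * gamma * r < s.
  apply: (@le_lt_trans _ _ (3 * gamma * (s / (4 * gamma)))).
    by rewrite ler_wpM2l ?mulr_ge0 ?(ltW gamma_gt0)// ge_min lexx orbT.
  rewrite (_ : _ * _ = 3 / 4 * s); first lra.
  by field; rewrite gt_eqF.
have zbar0 : (Nzbar `&` Linv c g Omega xb 0) zbar.
  split; last exact: KKT_Lmap.
  by apply: ballNz; rewrite subrr norm2_0.
have inv_near d : norm2 d <= r -> exists2 y,
    Lmap c g Omega xb y (flip d) & norm2 (y - zbar) <= gamma * norm2 d.
  move=> dr; have N0d : N0 (flip d) by apply: rN0; rewrite norm2_flip.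
  have [y [[Ny Ly] _]] := A3_single _ N0d; exists y => //.
  have := A3_lipschitz _ _ _ _ N0d _ (conj Ny Ly) zbar0.
  by rewrite subr0 norm2_flip; apply; apply: rN0; rewrite norm2_0 ltW.
have [rho rho_gt0 ballrho] :=
  (nbhs_norm2P _ _).1 (norm2_base_error c g zbar e A2 e_gt0).
(* The second bound makes the residual at zbar at most r / 4. *)
pose rho1 : R := Num.min rho (r / (4 * (kappa + 3 * e))).
have rho1_gt0 : 0 < rho1 by rewrite lt_min rho_gt0 divr_gt0 ?mulr_gt0.
have step z z' : norm2 (z - zbar) < rho1 ->
    KKTcvx c g Omega (xpart z) z' ->
    norm2 (z' - zbar) <= omega * norm2 (z - zbar).
  rewrite lt_min => /andP[z_rho z_r] z'KKT.
  set D := norm2 (z - zbar) in z_rho z_r *.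
  have D_ge0 : 0 <= D by exact: norm2_ge0.
  have hD : norm2 (xpart z - xb) <= D by rewrite -xpartB norm2_lsubmx_le.
  have [J_le a_le] := ballrho _ (le_lt_trans hD z_rho).
  set a := (X in norm2 X <= _) in a_le.
  have {}a_le : norm2 a <= (kappa + 3 * e) * D.
    apply: le_trans a_le _; apply: ler_pM; rewrite ?norm2_ge0//.
      by have := normF_ge0 (E_g g zbar); lra.
    by rewrite lerD2r.
  have a_r : norm2 a <= r / 4.
    apply: le_trans a_le _; move: z_r; rewrite ltr_pdivlMr ?mulr_gt0// => z_r.
    nra.
  pose w := z' - zbar.
  pose q := skew_error (jac g (xpart z) - jac g xb) w.
  have q_le : norm2 q <= 2 * e * norm2 w by exact: norm2_skew_error.
  have Lz' : Lmap c g Omega xb z' (a + q).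
    by rewrite -phihat_error_split -[_ - _]add0r; exact: Lmap_shift.
  have w_le : norm2 w <= 3 * gamma * r.
    apply: (monotone_localization (fun z d => Lmap c g Omega xb z (flip d))
      zbar z' (flip a) (flip q) gamma r (2 * e)) => //.
    - exact: monotone_Lmap.
    - by rewrite -flipD flipK.
    - by rewrite -[z' - zbar]flipK dotp_flip_flip dotp_skew_error.
    - by rewrite norm2_flip.
    - by rewrite norm2_flip.
    - lra.
  have aq_r : norm2 (a + q) <= r.
    apply: le_trans (norm2D_le _ _) _.
    have : 2 * e * norm2 w <= 2 * e * (3 * gamma * r).
      by rewrite ler_wpM2l// mulr_ge0// ltW.
    rewrite (_ : 2 * e * (3 * gamma * r) = 6 * (gamma * e) * r); last by ring.
    rewrite ge; nra.
  have N00 : N0 0 by apply: rN0; rewrite norm2_0 ltW.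
  have z'N : (Nzbar `&` Linv c g Omega xb (a + q)) z'.
    by split=> //; apply: ballNz; exact: le_lt_trans w_le rNz.
  have := A3_lipschitz _ _ _ _ (rN0 _ aq_r) N00 z'N zbar0.
  rewrite subr0 -/w => w_aq.
  rewrite /omega mulrAC ler_pdivlMr//.
  have : gamma * norm2 (a + q) <= gamma * ((kappa + 3 * e) * D + 2 * e * norm2 w).
    rewrite ler_wpM2l ?(ltW gamma_gt0)//.
    by apply: le_trans (norm2D_le _ _) _; exact: lerD.
  lra.
exists [set z | norm2 (z - zbar) < rho1], omega; split => //.
  by apply/nbhs_norm2P; exists rho1.
move=> z z0 [_ zS].
have z_near j : norm2 (z j - zbar) < rho1.
  elim: j => [//|j IH]; apply: le_lt_trans (step _ _ IH (zS j)) _.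
  by apply: le_lt_trans IH; rewrite ler_piMl ?norm2_ge0// ltW.
have z_contr j := step _ _ (z_near j) (zS j).
by split=> //; exact: contraction_converges_linearly z_contr.
Qed.
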